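(* Let $\mathcal{N}\subset\mathrm{Map}(U,\mathbb{R})$ be the normal set of a class $\mathfrak{M}(\cdot,\gamma f)$ of MDPs sharing the same state and action spaces, transition function $f$ and discount factor $\gamma\in[0,1)$, equipped with the relative topology. Then: (a) $\mathcal{N}=\bigcup_{\pi}\mathcal{N}_\pi$, the union being over all policies $\pi$, where $$\mathcal{N}_\pi:=\{r\in\mathrm{Map}(U,\mathbb{R}): r\le 0,\ r\circ\pi=0\}$$ is the set of normal rewards for which $\pi$ is optimal. (b) $\mathrm{Map}(U,\mathbb{R})$ is homeomorphic to the product $\mathcal{N}\times\mathrm{Map}(X,\mathbb{R})$, and the map $$\mathcal{P}:\mathrm{Map}(U,\mathbb{R})\to\mathcal{N},\qquad r\mapsto \ell_{v_{\pi^*,r}}(r),$$ where $v_{\pi^*,r}$ is the optimal value function of $\mathfrak{M}(r,\gamma f)$, is a continuous projection which makes $\mathrm{Map}(U,\mathbb{R})$ the total space of a principal bundle over $\mathcal{N}$ (with structure group the additive group $\mathrm{Map}(X,\mathbb{R})$ acting through $\ell$).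
   Context: $X$ is a finite set of states, $U$ is a finite set of actions with a projection $s:U\to X$ such that each fiber $U_x:=s^{-1}(x)$ is nonempty. $f:X\times U\to[0,1]$ is a transition function, $\sum_{z\in X}f(z,u)=1$ for all $u$; $\gamma\in[0,1)$ is the discount factor; $r:U\to\mathbb{R}$ is a reward function. $\mathfrak{M}(r,\gamma f)$ denotes the MDP with these data. A policy is a map $\pi:X\to U$ with $s\circ\pi=\mathrm{id}_X$. Its value function $v_{\pi,r}:X\to\mathbb{R}$ is the unique solution of $v(x)=r(\pi(x))+\gamma\sum_{z\in X}f(z,\pi(x))v(z)$ for all $x\in X$. A policy $\pi^*$ is optimal if $v_{\pi^*,r}\ge v_{\pi,r}$ pointwise for all policies $\pi$ (one always exists); $v_{\pi^*,r}$ is then the optimal value function. An MDP (or its reward) is normal if its optimal value function is identically zero. The normal set is $$\mathcal{N}:=\{r\in\mathrm{Map}(U,\mathbb{R}):\max_{u\in U_x}r(u)=0\ \ \forall x\in X\}.$$ For $\delta\in\mathrm{Map}(X,\mathbb{R})$ define $\ell_\delta(r):=r+b(\delta)$, where $b(\delta)(u):=\gamma\sum_{z\in X}f(z,u)\delta(z)-\delta(s(u))$. This is an action of the additive (abelian) group $\mathrm{Map}(X,\mathbb{R})$ on $\mathrm{Map}(U,\mathbb{R})$. $\mathrm{Map}(U,\mathbb{R})$ and $\mathrm{Map}(X,\mathbb{R})$ carry the standard topologies of $\mathbb{R}^{|U|}$ and $\mathbb{R}^{|X|}$. Inequalities between functions are pointwise. A principal $G$-bundle is a fiber bundle with model fiber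 the topological group $G$ whose total space carries a continuous fiber-preserving right $G$-action that is free, transitive on each fiber, and for which the local trivializations are $G$-equivariant. *)

(* Defs.v *)
From HB Require Import structures.
From mathcomp Require Import all_boot all_order all_algebra.
From mathcomp Require Import all_classical all_reals all_analysis.

Set Implicit Arguments.
Unset Strict Implicit.
Unset Printing Implicit Defensive.

Import Order.TTheory GRing.Theory Num.Theory.
Import numFieldNormedType.Exports.

Local Open Scope classical_set_scope.
Local Open Scope ring_scope.

(* Function types carry no global topology in the library; for a finite domain
   the product topology below is the standard topology of R^|T|. *)
Definition Map (T : finType) (R : realType) : Type := {ptws T -> R}.

HB.instance Definition _ (T : finType) (R : realType) :=
  Topological.copy (Map T R) {ptws T -> R}.
HB.instance Definition _ (T : finType) (R : realType) :=
  GRing.Zmodule.copy (Map T R) (T -> R).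

Lemma Map_continuousP (T : finType) (R : realType) (S : topologicalType)
    (h : S -> Map T R) :
  (forall t, continuous (fun x => h x t : R)) -> continuous h.
Proof.
move=> hc x; apply/cvg_sup => t A [_ [[B oB <-] Bhx] BA].
suff hA : nbhs x (h @^-1` A) by [].
have hB : nbhs x ((fun y => h y t : R) @^-1` B).
  by apply: (hc t x B); apply: open_nbhs_nbhs; split.
by apply: filterS hB => y; exact: BA.
Qed.

Lemma Map_eval_continuous (T : finType) (R : realType) (t : T) :
  continuous (fun h : Map T R => h t : R).
Proof. exact: (@proj_continuous T (fun=> R) t). Qed.

Lemma Map_sub_continuous (T : finType) (R : realType) :
  continuous (fun x : Map T R * Map T R => x.1 - x.2).
Proof.
apply: Map_continuousP => t x.
have ev1 : (x0.1 t : R) @[x0 --> x] --> (x.1 t : R).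
  apply: (@continuous_comp _ _ _ fst (fun h : Map T R => h t : R)).
    exact: cvg_fst.
  exact: Map_eval_continuous.
have ev2 : (x0.2 t : R) @[x0 --> x] --> (x.2 t : R).
  apply: (@continuous_comp _ _ _ snd (fun h : Map T R => h t : R)).
    exact: cvg_snd.
  exact: Map_eval_continuous.
exact: (@cvgB R R^o _ _ _ (fun y : Map T R * Map T R => y.1 t)
  (fun y : Map T R * Map T R => y.2 t) _ _ ev1 ev2).
Qed.

HB.instance Definition _ (T : finType) (R : realType) :=
  PreTopologicalNmodule_isTopologicalZmodule.Build (Map T R)
    (@Map_sub_continuous T R).

Definition homeomorphism (S T : topologicalType) (h : S -> T) : Prop :=
  continuous h /\
  exists k : T -> S, [/\ cancel h k, cancel k h & continuous k].

Definition homeomorphic (S T : topologicalType) : Prop :=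
  exists h : S -> T, homeomorphism h.

(* A local trivialization over V of p : E -> B, equivariant for the right
   translation action of G on V * G. Subsets of E and B are turned into
   topological spaces by the library's relative topology on [set_type]. *)
Definition equivariant_trivialization (G : topologicalZmodType)
    (E B : topologicalType) (p : E -> B) (act : E -> G -> E) (V : set B)
    (phi : set_type (p @^-1` V) -> set_type V * G) : Prop :=
  [/\ homeomorphism phi,
      forall e, \val (phi e).1 = p (\val e)
    & forall (e e' : set_type (p @^-1` V)) (g : G),
        \val e' = act (\val e) g -> phi e' = ((phi e).1, (phi e).2 + g)].

(* Principal G-bundle, for an abelian topological group G written additively. *)
Record principal_bundle (G : topologicalZmodType) (E B : topologicalType)
    (p : E -> B) (act : E -> G -> E) : Prop := PrincipalBundle {
  pb_proj_continuous : continuous p ;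
  pb_act0 : forall e, act e 0 = e ;
  pb_actD : forall e g h, act (act e g) h = act e (g + h) ;
  pb_act_continuous : continuous (fun x : E * G => act x.1 x.2) ;
  pb_fiber_preserving : forall e g, p (act e g) = p e ;
  pb_free : forall e g, act e g = e -> g = 0 ;
  pb_transitive : forall e e', p e = p e' -> exists g, act e g = e' ;
  pb_locally_trivial : forall b : B, exists2 V : set B, open_nbhs b V &
    exists phi : set_type (p @^-1` V) -> set_type V * G,
      equivariant_trivialization act phi
}.

Section MDP.
Context {R : realType} {X U : finType}.
Variables (s : U -> X) (f : X -> U -> R) (gamma : R).

Definition policy (pi : X -> U) : Prop := forall x, s (pi x) = x.

Definition bellman (pi : X -> U) (r : Map U R) (v : Map X R) : Prop :=
  forall x, v x = r (pi x) + gamma * \sum_(z : X) f z (pi x) * v z.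

(* [xget] returns the solution of the fixed-point equation, which exists and is
   unique for a transition function f and 0 <= gamma < 1. *)
Definition value (pi : X -> U) (r : Map U R) : Map X R :=
  xget 0 [set v | bellman pi r v].

Definition optimal (r : Map U R) (pi : X -> U) : Prop :=
  policy pi /\
  forall pi', policy pi' -> forall x, value pi' r x <= value pi r x.

(* The common value function of the optimal policies (one always exists). *)
Definition optimal_value (r : Map U R) : Map X R :=
  xget 0 [set v | exists2 pi, optimal r pi & v = value pi r].

Definition normal (r : Map U R) : Prop := optimal_value r = 0.

(* The maximum over the fiber U_x is taken in the extended reals so that it has
   a neutral element; fibers are nonempty, so its value is a real number. *)
Definition normal_set : set (Map U R) :=
  [set r | forall x, \big[maxe/-oo%E]_(u : U | s u == x) (r u)%:E = 0%E].

Definition normal_set_of (pi : X -> U) : set (Map U R) :=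
  [set r | (forall u, r u <= 0) /\ (forall x, r (pi x) = 0)].

Definition bdry (delta : Map X R) : Map U R :=
  fun u => gamma * (\sum_(z : X) f z u * delta z) - delta (s u).

Definition ell (delta : Map X R) (r : Map U R) : Map U R := r + bdry delta.

End MDP.

(* Main.v *)
(* Acting by b(delta) translates optimal values: V(r + b(delta)) = V(r) - delta.
   Moreover v solves Bellman's optimality equation for r exactly when the reward
   r + b(v) is in the normal set. Hence r |-> (r + b(V r), - V r) is a global
   equivariant homeomorphism onto N * Map(X, R), with inverse
   (n, delta) |-> n + b(delta), and the bundle is trivial. Continuity of V is
   the Lipschitz bound |V r - V r'| <= |r - r'| / (1 - gamma). *)
Require Import Defs.
From HB Require Import structures.
From mathcomp Require Import all_boot all_order all_algebra.
From mathcomp Require Import all_classical all_reals all_analysis.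
From mathcomp Require Import ring lra.

Import Order.TTheory GRing.Theory Num.Theory.
Import numFieldNormedType.Exports.

Local Open Scope classical_set_scope.
Local Open Scope ring_scope.

(** * Bellman's optimality equation: comparison and existence *)

Definition lookahead {R : realType} {X U : finType} (f : X -> U -> R)
    (gamma : R) (r : U -> R) (v : X -> R) (u : U) : R :=
  r u + gamma * \sum_(z : X) f z u * v z.

(** The maximum over a fiber is encoded as an upper bound that is attained, the same two clauses
    that describe membership in the normal set. *)
Definition bellman_optimal {R : realType} {X U : finType} (s : U -> X)
    (f : X -> U -> R) (gamma : R) (r : U -> R) (v : X -> R) : Prop :=
  (forall u, lookahead f gamma r v u <= v (s u)) /\
  (forall x, exists2 u, s u = x & v x = lookahead f gamma r v u).

Section Bellman.
Context {R : realType} {X U : finType} (s : U -> X) (f : X -> U -> R).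
Context (gamma : R) (s_fibers : forall x : X, exists u : U, s u = x).
Context (f_range : forall (z : X) (u : U), 0 <= f z u <= 1).
Context (f_sum : forall u : U, \sum_(z : X) f z u = 1).
Context (gamma_range : 0 <= gamma < 1).

Local Notation Q := (lookahead f gamma).

(** Averaging against the probability weights [f z u] keeps inequalities and constants, and
    discounting scales the constant by [gamma]: monotonicity and contraction at once. *)
Lemma lookahead_le_shift (r : U -> R) (v w : X -> R) (e : R) (u : U) :
  (forall z, v z <= w z + e) -> Q r v u <= Q r w u + gamma * e.
Proof.
move=> vw; rewrite /lookahead -addrA lerD2l -mulrDr.
have /andP[g0 _] := gamma_range.
apply: ler_wpM2l => //.
rewrite -[e in leRHS]mul1r -(f_sum u) mulr_suml -big_split /=.
apply: ler_sum => z _; rewrite -mulrDr.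
by apply: ler_wpM2l => //; have /andP[] := f_range z u.
Qed.

Lemma lookahead_mono (r : U -> R) (v w : X -> R) (u : U) :
  (forall z, v z <= w z) -> Q r v u <= Q r w u.
Proof.
move=> vw; rewrite -[leRHS]addr0 -(mulr0 gamma).
by apply: lookahead_le_shift => z; rewrite addr0.
Qed.

(* Evaluate at a state where v - w is maximal: that maximum d satisfies
   d <= e + gamma * d. *)
Lemma bellman_comparison (r r' : U -> R) (pi : X -> U) (v w : X -> R) (e : R) :
  (forall x, v x <= Q r v (pi x)) -> (forall x, Q r' w (pi x) <= w x) ->
  (forall u, r u <= r' u + e) ->
  forall x, v x <= w x + e / (1 - gamma).
Proof.
move=> hv hw hr x.
(* The given [x] shows that [X] is nonempty, so a maximum exists. *)
have [x0 _ x0max] := arg_maxP (fun y => v y - w y) (isT : xpredT x).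
have /andP[g0 g1] := gamma_range.
have step : Q r v (pi x0) <= Q r w (pi x0) + gamma * (v x0 - w x0).
  by apply: lookahead_le_shift => z; rewrite -lerBlDl; exact: x0max.
have rr' : Q r w (pi x0) <= Q r' w (pi x0) + e.
  by rewrite /lookahead addrAC lerD2r.
have h1 : (v x0 - w x0) * (1 - gamma) <= e.
  by have := hv x0; have := hw x0; lra.
rewrite -lerBlDl; apply: (le_trans (x0max x isT)).
by rewrite ler_pdivlMr // subr_gt0.
Qed.

Lemma bellman_comparison0 (r : U -> R) (pi : X -> U) (v w : X -> R) :
  (forall x, v x <= Q r v (pi x)) -> (forall x, Q r w (pi x) <= w x) ->
  forall x, v x <= w x.
Proof.
move=> hv hw x; rewrite -[leRHS]addr0 -(mul0r (1 - gamma)^-1).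
by apply: (bellman_comparison _ _ _ _ _ _ hv hw) => u; rewrite addr0.
Qed.

Lemma exists_greedy (q : U -> R) :
  exists2 pi, policy s pi & forall u, q u <= q (pi (s u)).
Proof.
have [p0 p0P] := choice s_fibers.
pose pi x := [arg max_(u > p0 x | s u == x) q u]%O.
have piP x : s (pi x) = x /\ forall u, s u = x -> q u <= q (pi x).
  rewrite /pi; case: arg_maxP => [|u /eqP su umax]; first exact/eqP.
  by split=> // u' /eqP; exact: umax.
by exists pi => [x|u]; [exact: (piP x).1 | exact: (piP (s u)).2].
Qed.

(* Perron's method: the pointwise supremum of the subsolutions is a solution. *)
Lemma bellman_optimal_exists (r : U -> R) :
  exists v, bellman_optimal s f gamma r v.
Proof.
have /andP[g0 g1] := gamma_range.
have g1' : 0 < 1 - gamma by rewrite subr_gt0.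
pose W : set (X -> R) :=
  [set v | exists2 pi, policy s pi & forall x, v x <= Q r v (pi x)].
pose M := \sum_u `|r u|.
have rM u : `|r u| <= M by rewrite /M (bigD1 u) //= lerDl sumr_ge0.
(* The comparison of reward [r] with reward 0, whose solution is 0, has error [M] and yields the
   bound [c]. Since [M = c * (1 - gamma)], the constant [- c] is a subsolution, so the supremum is
   over a nonempty set. *)
pose c := M / (1 - gamma).
have Wub v : W v -> forall x, v x <= c.
  move=> [pi _ hv] x; rewrite -[leRHS]add0r.
  apply: (bellman_comparison r (fun=> 0) pi v (fun=> 0)) => // [y|u].
    by rewrite /lookahead big1 ?mulr0 ?addr0 // => z _; rewrite mulr0.
  by rewrite add0r (le_trans (ler_norm _)).
have [p0 p0P] := choice s_fibers.
have W0 : W (fun=> - c).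
  exists p0 => // x; rewrite /lookahead -mulr_suml f_sum mul1r.
  have := rM (p0 x); rewrite ler_norml => /andP[+ _].
  have -> : M = c * (1 - gamma) by rewrite /c mulfVK // gt_eqF.
  lra.
pose V x := sup [set v x | v in W].
have leV v : W v -> forall x, v x <= V x.
  move=> Wv x; apply: ub_le_sup; last by exists v.
  by exists c => _ [w Ww <-]; exact: Wub.
have [pi piP pimax] := exists_greedy (Q r V).
have VQ x : V x <= Q r V (pi x).
  apply: ge_sup; first by exists (- c), (fun=> - c).
  move=> _ [v Wv <-]; have [pi' pi'P hv] := Wv.
  apply: (le_trans (hv x)); apply: (@le_trans _ _ (Q r V (pi' x))).
    by apply: lookahead_mono; exact: leV.
  by have := pimax (pi' x); rewrite pi'P.
(* Applying the monotone lookahead to [VQ] shows that [Q r V] along [pi] is again a subsolution,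
   hence lies below the supremum. *)
have QV x : Q r V (pi x) <= V x.
  apply: (leV (fun y => Q r V (pi y))); exists pi => // y.
  exact: lookahead_mono.
exists V; split=> [u|x]; first exact: le_trans (pimax u) (QV _).
by exists (pi x) => //; apply/eqP; rewrite eq_le VQ QV.
Qed.

End Bellman.

(** * Values of policies and the optimal value function *)

Section Value.
Context {R : realType} {X U : finType} (s : U -> X) (f : X -> U -> R).
Context (gamma : R) (s_fibers : forall x : X, exists u : U, s u = x).
Context (f_range : forall (z : X) (u : U), 0 <= f z u <= 1).
Context (f_sum : forall u : U, \sum_(z : X) f z u = 1).
Context (gamma_range : 0 <= gamma < 1).

Local Notation Q := (lookahead f gamma).

(* A policy pi turns the process into one with a single action per state,
   for which the optimality equation is the equation of the value of pi. *)
Lemma bellman_exists (pi : X -> U) (r : Map U R) :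
  exists v, bellman f gamma pi r v.
Proof.
have [|z x|x||v [_ hv]] := @bellman_optimal_exists R X X id
  (fun z x => f z (pi x)) gamma _ _ _ _ (r \o pi) => //.
  by move=> x; exists x.
by exists v => x; have [y <-] := hv x.
Qed.

Lemma bellman_unique (pi : X -> U) (r : Map U R) (v w : Map X R) :
  bellman f gamma pi r v -> bellman f gamma pi r w -> v = w.
Proof.
move=> hv hw; apply/funext => x; apply/eqP; rewrite eq_le.
by apply/andP; split; apply: (bellman_comparison0 f gamma f_range f_sum
  gamma_range r pi) => y; rewrite /lookahead -?hv -?hw.
Qed.

Lemma valueE (pi : X -> U) (r : Map U R) (v : Map X R) :
  bellman f gamma pi r v -> value f gamma pi r = v.
Proof.
move=> hv; by apply: xget_unique => // w hw; exact: bellman_unique hw hv.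
Qed.

Lemma value_bellman (pi : X -> U) (r : Map U R) :
  bellman f gamma pi r (value f gamma pi r).
Proof. by have [v hv] := bellman_exists pi r; rewrite (valueE _ _ _ hv). Qed.

(** The value of [pi] solves its own equation, and [v] is a supersolution along every policy, so
    comparison applies. *)
Lemma value_le (r : Map U R) (v : Map X R) (pi : X -> U) :
  bellman_optimal s f gamma r v -> policy s pi ->
  forall x, value f gamma pi r x <= v x.
Proof.
move=> [hv _] piP; apply: (bellman_comparison0 f gamma f_range f_sum
  gamma_range r pi) => x.
  by rewrite {1}(value_bellman pi r x).
by rewrite -[X in _ <= v X]piP; exact: hv.
Qed.

(** Choosing an action that attains the maximum at each state gives a policy whose linear equation
    is solved by [v]. *)
Lemma bellman_optimal_value (r : Map U R) (v : Map X R) :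
  bellman_optimal s f gamma r v ->
  exists2 pi, optimal s f gamma r pi & value f gamma pi r = v.
Proof.
move=> vP; have [_ hv] := vP.
have /choice[pi hpi] x : exists u, s u = x /\ v x = Q r v u.
  by have [u su vu] := hv x; exists u.
have vE : value f gamma pi r = v by apply: valueE => x; exact: (hpi x).2.
exists pi => //; split=> [x|pi' pi'P x]; first exact: (hpi x).1.
by rewrite vE; exact: value_le.
Qed.

(** Two optimal policies bound each other's values, so the choice made by [xget] is forced. From
    here on the optimal value is handled through the optimality equation alone. *)
Lemma optimal_valueE (r : Map U R) (v : Map X R) :
  bellman_optimal s f gamma r v -> optimal_value s f gamma r = v.
Proof.
move=> vP; have [pi opi vE] := bellman_optimal_value r v vP.
apply: xget_unique; first by exists pi.
move=> w [pi' [pi'P opi'] ->]; apply/funext => x; apply/eqP.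
rewrite eq_le value_le //= -vE; apply: opi'; exact: opi.1.
Qed.

Lemma optimal_valueP (r : Map U R) :
  bellman_optimal s f gamma r (optimal_value s f gamma r).
Proof.
have [v vP] := bellman_optimal_exists s f gamma s_fibers f_range f_sum
  gamma_range r.
by rewrite (optimal_valueE r v vP).
Qed.

Lemma value_optimal (r : Map U R) (pi : X -> U) :
  optimal s f gamma r pi -> value f gamma pi r = optimal_value s f gamma r.
Proof.
move=> opi; have [pi' opi' <-] := bellman_optimal_value r _ (optimal_valueP r).
apply/funext => x; apply/eqP; rewrite eq_le.
by rewrite (opi'.2 _ opi.1) (opi.2 _ opi'.1).
Qed.

Lemma optimal_value_dist (r r' : Map U R) (e : R) :
  (forall u, `|r u - r' u| <= e) ->
  forall x, `|optimal_value s f gamma r x - optimal_value s f gamma r' x|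
    <= e / (1 - gamma).
Proof.
(* Along a policy greedy for [r1], the optimal value of [r1] is a subsolution, while that of [r2] is
   a supersolution along any policy. Exchanging the rewards gives the other side. *)
have half (r1 r2 : Map U R) : (forall u, r1 u <= r2 u + e) -> forall x,
    optimal_value s f gamma r1 x <=
      optimal_value s f gamma r2 x + e / (1 - gamma).
  move=> h12; have [_ h1] := optimal_valueP r1; have [h2 _] := optimal_valueP r2.
  have /choice[pi hpi] x : exists u, s u = x /\
      optimal_value s f gamma r1 x = Q r1 (optimal_value s f gamma r1) u.
    by have [u su vu] := h1 x; exists u.
  apply: (bellman_comparison f gamma f_range f_sum gamma_range r1 r2 pi) => //.
    by move=> x; rewrite {1}(hpi x).2.
  by move=> x; rewrite -[X in _ <= _ X](hpi x).1; exact: h2.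
move=> hr x; rewrite ler_distl lerBlDr !half // => u.
  by have := hr u; rewrite ler_distl => /andP[]; lra.
by have := hr u; rewrite ler_distl => /andP[]; lra.
Qed.

Lemma normal_setP (r : Map U R) :
  normal_set s r <->
  (forall u, r u <= 0) /\ forall x, exists2 u, s u = x & r u = 0.
Proof.
split=> [nr|[r0 hr] x].
  have r0 u : r u <= 0.
    have : ((r u)%:E <= 0)%E by rewrite -(nr (s u)); apply: le_bigmax_cond.
    by rewrite lee_fin.
  split=> // x; have [u0 su0] := s_fibers x.
  (* The fiber contains [u0] and no reward lies below the neutral element, so the maximum is
     attained at an action of the fiber. *)
  have := nr x; rewrite (bigmax_eq_arg _ u0) ?su0 //; last first.
    by move=> i _; rewrite leNye.
  case: arg_maxP => [|u /eqP su _ [ru]]; first exact/eqP.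
  by exists u.
have [u su ru] := hr x; apply/eqP; rewrite eq_le; apply/andP; split.
  by apply: bigmax_le => // i _; rewrite lee_fin.
have <- : (r u)%:E = 0%E by rewrite ru.
by apply: le_bigmax_cond; exact/eqP.
Qed.

(** The shifted reward is the advantage [Q r v u - v (s u)]; being nonpositive, with a zero in each
    fiber, is the optimality equation for [v]. *)
Lemma normal_set_bellman_optimal (r : Map U R) (v : Map X R) :
  normal_set s (ell s f gamma v r) <-> bellman_optimal s f gamma r v.
Proof.
have E u : ell s f gamma v r u = Q r v u - v (s u) by exact: addrA.
rewrite normal_setP; split=> -[h1 h2]; split.
- by move=> u; rewrite -subr_le0 -E.
- move=> x; have [u <- /eqP] := h2 x; rewrite E subr_eq0 => /eqP ru.
  by exists u.
- by move=> u; rewrite E subr_le0.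
- by move=> x; have [u su vu] := h2 x; exists u; rewrite ?E ?su ?vu ?subrr.
Qed.

End Value.

(** * Continuity and bundles with a global trivialization *)

Lemma continuous_to_set_type (S T : topologicalType) (A : set T)
    (h : S -> set_type A) :
  continuous (fun x => \val (h x)) -> continuous h.
Proof. by move=> hc; apply: continuous_comp_initial; exact: hc. Qed.

Lemma continuous_val_set_type (T : topologicalType) (A : set T) :
  continuous (fun x : set_type A => \val x).
Proof. exact: initial_continuous. Qed.

Lemma continuous_pair (S T1 T2 : topologicalType) (g : S -> T1) (h : S -> T2) :
  continuous g -> continuous h -> continuous (fun x => (g x, h x)).
Proof. by move=> gc hc x; apply: cvg_pair; [exact: gc | exact: hc]. Qed.

Lemma continuous_compose (S T V : topologicalType) (g : S -> T) (h : T -> V) :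
  continuous g -> continuous h -> continuous (fun x => h (g x)).
Proof. by move=> gc hc x; apply: continuous_comp; [exact: gc | exact: hc]. Qed.

(** Each axiom is transported along [h] from translation on the second factor of [B * G]. *)
Lemma principal_bundle_trivial (G : topologicalZmodType) (E B : topologicalType)
    (p : E -> B) (act : E -> G -> E) (h : E -> B * G) :
  homeomorphism h -> (forall e, (h e).1 = p e) ->
  (forall e g, h (act e g) = ((h e).1, (h e).2 + g)) ->
  principal_bundle p act.
Proof.
move=> [hc [k [hk kh kc]]] hp hact.
have hI : injective h := can_inj hk.
have actE e g : act e g = k ((h e).1, (h e).2 + g) by rewrite -hact hk.
split.
- have -> : p = fun e => (h e).1 by apply/funext => e; rewrite hp.
  by apply: (continuous_compose _ _ _ h fst) => // x; exact: cvg_fst.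
- by move=> e; apply: hI; rewrite hact addr0 -surjective_pairing.
- by move=> e g g'; apply: hI; rewrite !hact addrA.
- have -> : (fun x : E * G => act x.1 x.2) =
      fun x => k ((h x.1).1, (h x.1).2 + x.2).
    by apply/funext => x; exact: actE.
  have hx : continuous (fun x : E * G => h x.1).
    by apply: (continuous_compose _ _ _ fst h) => // x; exact: cvg_fst.
  apply: (continuous_compose _ _ _ _ k) kc; apply: continuous_pair.
    by apply: (continuous_compose _ _ _ _ fst) hx _ => x; exact: cvg_fst.
  apply: (continuous_compose _ _ _ (fun x : E * G => ((h x.1).2, x.2))
    (fun y => y.1 + y.2)); last exact: add_continuous.
  apply: continuous_pair; last by move=> x; exact: cvg_snd.
  by apply: (continuous_compose _ _ _ _ snd) hx _ => x; exact: cvg_snd.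
- by move=> e g; rewrite -!hp hact.
- move=> e g /(congr1 h); rewrite hact => /(congr1 snd) /= hg.
  by apply: (addrI (h e).2); rewrite hg addr0.
(* The translation carrying [e] to [e'] is the difference of their group coordinates. *)
- move=> e e' pe; exists ((h e').2 - (h e).2); apply: hI.
  by rewrite hact addrC subrK hp pe -hp -surjective_pairing.
(* The whole base serves as the trivializing neighborhood; [phi] and [psi] are [h] and its inverse
   [k], repackaged for the subtypes of full sets. *)
move=> b; exists setT; first by split=> //; exact: openT.
have inT (T : Type) (x : T) : x \in [set: T] by exact: in_setT.
pose phi (e : set_type (p @^-1` [set: B])) : set_type [set: B] * G :=
  (exist _ (h (\val e)).1 (inT _ _), (h (\val e)).2).
pose psi (y : set_type [set: B] * G) : set_type (p @^-1` [set: B]) :=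
  exist _ (k (\val y.1, y.2)) (mem_set I).
have hv : continuous (fun e : set_type (p @^-1` [set: B]) => h (\val e)).
  by apply: (continuous_compose _ _ _ _ h) hc; exact: continuous_val_set_type.
exists phi; split.
- split.
    apply: continuous_pair.
      apply: continuous_to_set_type => /=.
      by apply: (continuous_compose _ _ _ _ fst) hv _ => x; exact: cvg_fst.
    by apply: (continuous_compose _ _ _ _ snd) hv _ => x; exact: cvg_snd.
  exists psi; split.
  + by move=> e; apply: val_inj; rewrite /= -surjective_pairing hk.
  + move=> [y g]; rewrite /phi /psi; congr pair => /=; last by rewrite kh.
    by apply: val_inj; rewrite /= kh.
  apply: continuous_to_set_type => /=.
  apply: (continuous_compose _ _ _ _ k) kc; apply: continuous_pair.
    apply: (continuous_compose _ (set_type [set: B]) _ fst (fun y => \val y)).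
      by move=> x; exact: cvg_fst.
    exact: continuous_val_set_type.
  by move=> x; exact: cvg_snd.
- by move=> e; rewrite /= hp.
by move=> e e' g ee'; rewrite /phi ee' hact /=; congr pair.
Qed.

(** * The action of [ell] *)

Lemma ellD {R : realType} {X U : finType} (s : U -> X) (f : X -> U -> R)
    (gamma : R) (d e : Map X R) (r : Map U R) :
  ell s f gamma e (ell s f gamma d r) = ell s f gamma (d + e) r.
Proof.
apply/funext => u; rewrite /ell /bdry.
change (r u + (gamma * (\sum_z f z u * d z) - d (s u)) +
  (gamma * (\sum_z f z u * e z) - e (s u)) =
  r u + (gamma * (\sum_z f z u * (d z + e z)) - (d (s u) + e (s u)))).
under [in RHS]eq_bigr do rewrite mulrDr.
rewrite big_split /=; ring.
Qed.

Lemma ell0 {R : realType} {X U : finType} (s : U -> X) (f : X -> U -> R)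
    (gamma : R) (r : Map U R) :
  ell s f gamma 0 r = r.
Proof.
apply/funext => u; rewrite /ell /bdry.
change (r u + (gamma * (\sum_z f z u * 0) - 0) = r u).
by rewrite big1 ?mulr0 ?subr0 ?addr0 // => z _; rewrite mulr0.
Qed.

Lemma ell_continuous {R : realType} {X U : finType} (s : U -> X)
    (f : X -> U -> R) (gamma : R) :
  continuous (fun x : Map U R * Map X R => ell s f gamma x.2 x.1).
Proof.
apply: Map_continuousP => u.
have ev1 (t : U) : continuous (fun x : Map U R * Map X R => x.1 t : R).
  apply: (continuous_compose _ (Map U R) _ fst (fun h : Map U R => h t : R)).
    by move=> x; exact: cvg_fst.
  exact: Map_eval_continuous.
have ev2 (t : X) : continuous (fun x : Map U R * Map X R => x.2 t : R).
  apply: (continuous_compose _ (Map X R) _ snd (fun h : Map X R => h t : R)).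
    by move=> x; exact: cvg_snd.
  exact: Map_eval_continuous.
have sumc : continuous (fun x : Map U R * Map X R => \sum_z f z u * x.2 z : R).
  apply: (@continuous_big R X +%R 0 xpredT (@add_continuous R)) => z _ x.
  exact: (@cvgMl_tmp R _ _ _ (fun y : Map U R * Map X R => y.2 z : R) _ _
    (ev2 z x)).
move=> x; apply: (@cvgD R R^o _ _ _
  (fun y : Map U R * Map X R => y.1 u : R)
  (fun y => gamma * (\sum_z f z u * y.2 z) - y.2 (s u) : R) _ _ (ev1 u x)).
apply: (@cvgB R R^o _ _ _
  (fun y : Map U R * Map X R => gamma * (\sum_z f z u * y.2 z) : R)
  (fun y => y.2 (s u) : R) _ _ _ (ev2 (s u) x)).
exact: (@cvgMl_tmp R _ _ _
  (fun y : Map U R * Map X R => \sum_z f z u * y.2 z : R) _ _ (sumc x)).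
Qed.

(** * Normalization of rewards and the bundle over the normal set *)

Section NormalBundle.
Context {R : realType} {X U : finType} (s : U -> X) (f : X -> U -> R).
Context (gamma : R) (s_fibers : forall x : X, exists u : U, s u = x).
Context (f_range : forall (z : X) (u : U), 0 <= f z u <= 1).
Context (f_sum : forall u : U, \sum_(z : X) f z u = 1).
Context (gamma_range : 0 <= gamma < 1).

Local Notation V := (optimal_value s f gamma).
Local Notation L := (ell s f gamma).

Lemma optimal_value_continuous : continuous (V : Map U R -> Map X R).
Proof.
have /andP[_ g1] := gamma_range.
apply: Map_continuousP => x r.
apply: (@cvgrPdist_le R R^o (Map U R) (nbhs r) _ (fun r' => V r' x : R)
  (V r x)).2 => e e0.
(* This radius cancels the Lipschitz constant [1 / (1 - gamma)]; finiteness of [U] makes it uniform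
   over actions near [r]. *)
have e0' : 0 < e * (1 - gamma) by rewrite mulr_gt0 // subr_gt0.
have near_r : \forall r' \near r, forall u, `|r u - r' u| <= e * (1 - gamma).
  apply: (@filter_forall _ _
    (fun u r' => `|r u - r' u| <= e * (1 - gamma)) (nbhs r)) => u.
  exact: (@cvgrPdist_le R R^o (Map U R) (nbhs r) _ (fun r' => r' u : R)
    (r u)).1 (@Map_eval_continuous U R u r) _ e0'.
apply: filterS near_r => r' /(optimal_value_dist s f gamma s_fibers f_range
  f_sum gamma_range)/(_ x).
by rewrite mulfK // gt_eqF // subr_gt0.
Qed.

Lemma normal_ell_optimal_value (r : Map U R) : normal_set s (L (V r) r).
Proof.
by apply/(normal_set_bellman_optimal s f gamma s_fibers); exact: optimal_valueP.
Qed.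

(** With the previous lemma: every orbit meets the normal set, and only the shift by [V r] takes [r]
    there. *)
Lemma optimal_value_unique (r : Map U R) (v : Map X R) :
  normal_set s (L v r) -> V r = v.
Proof.
by move/(normal_set_bellman_optimal s f gamma s_fibers); exact: optimal_valueE.
Qed.

Lemma optimal_value_normal (n : Map U R) : normal_set s n -> V n = 0.
Proof. by move=> hn; apply: optimal_value_unique; rewrite ell0. Qed.

(** Shifting [L d r] further by [V r - d] gives the normal reward [L (V r) r], and such a shift is
    unique. *)
Lemma optimal_value_ell (r : Map U R) (d : Map X R) : V (L d r) = V r - d.
Proof.
apply: optimal_value_unique; rewrite ellD addrC subrK.
exact: normal_ell_optimal_value.
Qed.

Definition normalize (r : Map U R) : set_type (normal_set (R := R) s) :=
  exist _ (L (V r) r) (mem_set (normal_ell_optimal_value r)).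

Lemma normalize_ell (r : Map U R) (d : Map X R) :
  normalize (L d r) = normalize r.
Proof. by apply: val_inj; rewrite /= ellD optimal_value_ell addrC subrK. Qed.

Lemma normalize_normal (n : set_type (normal_set (R := R) s)) :
  normalize (\val n) = n.
Proof.
apply: val_inj; rewrite /= optimal_value_normal ?ell0 //.
exact: (set_valP n).
Qed.

Lemma normalize_continuous : continuous normalize.
Proof.
apply: continuous_to_set_type => /=.
apply: (continuous_compose _ _ _ (fun r : Map U R => (r, V r))
  (fun x => L x.2 x.1)); last exact: ell_continuous.
by apply: continuous_pair; [move=> r; exact: cvg_id |
  exact: optimal_value_continuous].
Qed.

(** The action by [d] lowers [V] by [d], so the sign in [- V r] turns the action into translation by
    [+ d]; acting by [- V r] undoes normalization. *)
Lemma normalize_homeomorphism :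
  homeomorphism (fun r : Map U R => (normalize r, - V r)).
Proof.
split.
  apply: continuous_pair; first exact: normalize_continuous.
  apply: (continuous_compose _ _ _ _ (-%R)); last exact: opp_continuous.
  exact: optimal_value_continuous.
exists (fun y => L y.2 (\val y.1)); split.
- by move=> r; rewrite /= ellD subrr ell0.
- move=> [n d] /=; rewrite normalize_ell normalize_normal.
  rewrite optimal_value_ell optimal_value_normal ?sub0r ?opprK //.
  exact: (set_valP n).
apply: (continuous_compose (set_type (normal_set (R := R) s) * Map X R)%type
  (Map U R * Map X R)%type (Map U R) (fun y => (\val y.1, y.2))
  (fun x => L x.2 x.1)); last exact: ell_continuous.
apply: continuous_pair; last by move=> y; exact: cvg_snd.
apply: (continuous_compose _ (set_type (normal_set (R := R) s)) _ fst
  (fun n => \val n)); last exact: continuous_val_set_type.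
by move=> y; exact: cvg_fst.
Qed.

Lemma normal_set_bigcup :
  normal_set s = \bigcup_(pi in [set pi : X -> U | policy s pi])
                    normal_set_of (R := R) pi.
Proof.
apply/seteqP; split=> r.
  move/(normal_setP s s_fibers) => [r0 hr].
  have /choice[pi hpi] x : exists u, s u = x /\ r u = 0.
    by have [u su ru] := hr x; exists u.
  by exists pi => [x|]; [exact: (hpi x).1 | split=> // x; exact: (hpi x).2].
move=> [pi piP [r0 rpi]]; apply/(normal_setP s s_fibers); split=> // x.
by exists (pi x).
Qed.

(** If [r] vanishes along [pi], then [pi] has value 0, which solves the optimality equation when [r]
    is normal. Conversely, an optimal [pi] has value 0, and its Bellman equation reduces to the
    vanishing of [r] along [pi]. *)
Lemma normal_set_ofE (pi : X -> U) : policy s pi ->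
  normal_set_of pi =
  [set r : Map U R | normal s f gamma r /\ optimal s f gamma r pi].
Proof.
move=> piP; have sum0 u : gamma * \sum_z f z u * (0 : Map X R) z = 0.
  by rewrite big1 ?mulr0 // => z _; exact: mulr0.
apply/seteqP; split=> r.
  move=> [r0 rpi]; have nr : normal_set s r.
    by rewrite normal_set_bigcup; exists pi.
  split; first exact: optimal_value_normal.
  have b0 : bellman_optimal s f gamma r (0 : Map X R).
    by apply/(normal_set_bellman_optimal s f gamma s_fibers); rewrite ell0.
  split=> // pi' pi'P x.
  rewrite (valueE f gamma f_range f_sum gamma_range pi r 0).
    by apply: (value_le s); eassumption.
  by move=> y; rewrite sum0 addr0 rpi.
move=> [nr opi]; have := normal_ell_optimal_value r; rewrite nr ell0.
move=> /(normal_setP s s_fibers)[r0 _]; split=> // x.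
have := value_bellman f gamma f_range f_sum gamma_range pi r x.
rewrite (value_optimal s f gamma s_fibers f_range f_sum gamma_range r pi opi) nr.
by rewrite sum0 addr0 => <-.
Qed.

End NormalBundle.

Theorem theorem12 (R : realType) (X U : finType)
    (s : U -> X) (f : X -> U -> R) (gamma : R)
    (s_fibers : forall x : X, exists u : U, s u = x)
    (f_range : forall (z : X) (u : U), 0 <= f z u <= 1)
    (f_sum : forall u : U, \sum_(z : X) f z u = 1)
    (gamma_range : 0 <= gamma < 1) :
  (normal_set s = \bigcup_(pi in [set pi : X -> U | policy s pi])
                     normal_set_of (R := R) pi
   /\ (forall pi : X -> U, policy s pi ->
         normal_set_of pi =
         [set r : Map U R | normal s f gamma r /\ optimal s f gamma r pi]))
  /\
  (homeomorphic (Map U R) (set_type (normal_set (R := R) s) * Map X R)%type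
   /\ exists P : Map U R -> set_type (normal_set (R := R) s),
        [/\ forall r : Map U R,
              \val (P r) = ell s f gamma (optimal_value s f gamma r) r,
            continuous P,
            forall n : set_type (normal_set (R := R) s), P (\val n) = n
          & principal_bundle P
              (fun (r : Map U R) (delta : Map X R) => ell s f gamma delta r)]).
Proof.
split; first split.
- exact: normal_set_bigcup.
- by move=> pi; exact: normal_set_ofE.
pose P := normalize s f gamma s_fibers f_range f_sum gamma_range.
have hP := normalize_homeomorphism s f gamma s_fibers f_range f_sum gamma_range.
split; first by exists (fun r => (P r, - optimal_value s f gamma r)).
exists P; split=> //.
- exact: normalize_continuous.
- exact: normalize_normal.
(* Equivariance of the global trivialization is the identity [- (V r - d) = - V r + d] in the group
   coordinate. *)
apply: (principal_bundle_trivial _ _ _ _ _ _ hP) => // r d /=.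
by rewrite normalize_ell optimal_value_ell // opprB addrC.
Qed.
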